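(* Let $\mathbb{K}$ be a field of characteristic zero, let $n\ge 3$, and let $R_3$ be the $(n+2)$-dimensional Leibniz algebra over $\mathbb{K}$ with basis $\{e_1,\dots,e_n,x,y\}$ and multiplication $$[e_1,e_1]=e_3,\qquad [e_i,e_1]=e_{i+1}\ (3\le i\le n-1),\qquad [e_1,x]=e_1,\qquad [x,e_1]=-e_1,$$ $$[e_i,x]=(i-1)e_i\ (3\le i\le n),\qquad [e_2,y]=e_2,$$ all other products of basis elements being zero. Then every 2-local automorphism of $R_3$ is an automorphism of $R_3$.
   Context: A Leibniz algebra over $\mathbb{K}$ is a $\mathbb{K}$-vector space $L$ with a bilinear product $[-,-]$ satisfying $[[x,y],z]=[[x,z],y]+[x,[y,z]]$ for all $x,y,z\in L$. An automorphism of an algebra $A$ is a bijective linear map $\varphi:A\to A$ with $\varphi([u,v])=[\varphi(u),\varphi(v)]$ for all $u,v\in A$. A (not necessarily linear) map $\phi:A\to A$ is called a 2-local automorphism if for all $u,v\in A$ there exists an automorphism $\phi_{u,v}:A\to A$ (depending on $u,v$) such that $\phi(u)=\phi_{u,v}(u)$ and $\phi(v)=\phi_{u,v}(v)$. *)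

(* Defs.v *)
From HB Require Import structures.
From mathcomp Require Import all_boot all_order all_algebra.
From mathcomp Require Import zify.

Set Implicit Arguments.
Unset Strict Implicit.
Unset Printing Implicit Defensive.

Import GRing.Theory.
Local Open Scope ring_scope.

Record leibnizAlgebra (K : fieldType) := LeibnizAlgebra {
  lb_carrier :> lmodType K;
  lb_br : lb_carrier -> lb_carrier -> lb_carrier;
  lb_linearl : forall v, linear (fun u => lb_br u v);
  lb_linearr : forall u, linear (lb_br u);
  lb_leibniz : forall u v w,
    lb_br (lb_br u v) w = lb_br (lb_br u w) v + lb_br u (lb_br v w)
}.

Definition automorphism (K : fieldType) (A : leibnizAlgebra K)
    (phi : A -> A) : Prop :=
  [/\ linear phi, bijective phi
    & forall u v, phi (lb_br u v) = lb_br (phi u) (phi v)].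

Definition two_local_automorphism (K : fieldType) (A : leibnizAlgebra K)
    (phi : A -> A) : Prop :=
  forall u v, exists psi : A -> A,
    [/\ automorphism psi, phi u = psi u & phi v = psi v].

Section R3.
Variables (K : fieldType) (n : nat).

(* The basis vectors are numbered from 1: [R3_basis k] is e_k for
   1 <= k <= n, while x and y are numbered n + 1 and n + 2.  For n >= 3,
   numbers outside [1, n + 2] are never used. *)
Definition R3_basis (k : nat) : 'rV[K]_n.+2 := delta_mx 0 (inord k.-1).

Local Notation e := R3_basis.
Local Notation ix := n.+1 (only parsing).
Local Notation iy := n.+2 (only parsing).

Definition R3_table (p q : nat) : 'rV[K]_n.+2 :=
  if (p == 1%N) && (q == 1%N) then e 3
  else if (3 <= p <= n.-1)%N && (q == 1%N) then e p.+1
  else if (p == 1%N) && (q == ix) then e 1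
  else if (p == ix) && (q == 1%N) then - e 1
  else if (3 <= p <= n)%N && (q == ix) then p.-1%:R *: e p
  else if (p == 2%N) && (q == iy) then e 2
  else 0.

Definition R3_br (u v : 'rV[K]_n.+2) : 'rV[K]_n.+2 :=
  \sum_(i < n.+2) \sum_(j < n.+2) (u 0 i * v 0 j) *: R3_table i.+1 j.+1.

Lemma R3_linearl v : linear (fun u => R3_br u v).
Proof.
move=> a u w; rewrite /R3_br scaler_sumr -big_split /=; apply: eq_bigr => i _.
rewrite scaler_sumr -big_split /=; apply: eq_bigr => j _.
by rewrite !mxE mulrDl scalerDl scalerA mulrA.
Qed.

Lemma R3_linearr u : linear (R3_br u).
Proof.
move=> a v w; rewrite /R3_br scaler_sumr -big_split /=; apply: eq_bigr => i _.
rewrite scaler_sumr -big_split /=; apply: eq_bigr => j _.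
by rewrite !mxE mulrDr scalerDl scalerA mulrCA.
Qed.

Lemma R3_br_basis p q : (0 < p <= n.+2)%N -> (0 < q <= n.+2)%N ->
  R3_br (e p) (e q) = R3_table p q.
Proof.
case: p => // p /= lep; case: q => // q /= leq.
rewrite /R3_br (bigD1 (inord p)) //= [X in _ + X]big1 ?addr0 => [|i nip].
  rewrite (bigD1 (inord q)) //= [X in _ + X]big1 ?addr0 => [|j njq].
    by rewrite !mxE !eqxx /= mulr1 scale1r !inordK.
  by rewrite !mxE (negbTE njq) mulr0 scale0r.
by apply: big1 => j _; rewrite !mxE (negbTE nip) mul0r scale0r.
Qed.

Lemma R3_leibniz (n_ge3 : (3 <= n)%N) u v w :
  R3_br (R3_br u v) w = R3_br (R3_br u w) v + R3_br u (R3_br v w).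
Proof.
have Dl a b c : R3_br (a + b) c = R3_br a c + R3_br b c.
  by have := R3_linearl c 1 a b; rewrite !scale1r.
have Zl k a c : R3_br (k *: a) c = k *: R3_br a c.
  have := R3_linearl c k a 0; rewrite !addr0 => ->.
  have := R3_linearl c (-1) 0 0.
  by rewrite !scaler0 addr0 scaleN1r addNr => ->; rewrite addr0.
have Dr a b c : R3_br a (b + c) = R3_br a b + R3_br a c.
  by have := R3_linearr a 1 b c; rewrite !scale1r.
have Zr k a c : R3_br a (k *: c) = k *: R3_br a c.
  have := R3_linearr a k c 0; rewrite !addr0 => ->.
  have := R3_linearr a (-1) 0 0.
  by rewrite !scaler0 addr0 scaleN1r addNr => ->; rewrite addr0.
have Ol c : R3_br 0 c = 0 by rewrite -[0](scale0r 0) Zl !scale0r.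
have Or c : R3_br c 0 = 0 by rewrite -[X in R3_br c X](scale0r 0) Zr !scale0r.
have basis (P : 'rV[K]_n.+2 -> Prop) :
    (forall a b, P a -> P b -> P (a + b)) -> (forall k a, P a -> P (k *: a)) ->
    (forall k, (0 < k <= n.+2)%N -> P (e k)) -> forall a, P a.
  move=> PD PZ Pe a; rewrite [a]row_sum_delta; apply: big_ind => //.
    by rewrite -(scale0r (e 1)); apply/PZ/Pe.
  move=> i _; apply: PZ; rewrite -[i]inord_val -[X in inord X]/(i.+1.-1).
  by apply: Pe => /=; apply: ltn_ord.
have N1l a c : R3_br (- a) c = - R3_br a c by rewrite -!scaleN1r Zl.
have N1r a c : R3_br c (- a) = - R3_br c a by rewrite -!scaleN1r Zr.
elim/basis: u => [a b Ha Hb|k a Ha|p hp].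
- by rewrite !Dl Ha Hb addrACA.
- by rewrite !Zl Ha scalerDr.
elim/basis: v => [a b Ha Hb|k a Ha|q hq].
- by rewrite !(Dl, Dr) Ha Hb addrACA.
- by rewrite !(Zl, Zr) Ha scalerDr.
elim/basis: w => [a b Ha Hb|k a Ha|r hr].
- by rewrite !(Dl, Dr) Ha Hb addrACA.
- by rewrite !(Zl, Zr) Ha scalerDr.
have table : forall i j, (0 < i <= n.+2)%N -> (0 < j <= n.+2)%N ->
    R3_br (e i) (e j) = R3_table i j by exact: R3_br_basis.
have e11 : R3_br (e 1) (e 1) = e 3 by rewrite table.
have ei1 i : (3 <= i <= n.-1)%N -> R3_br (e i) (e 1) = e i.+1.
  by move=> hi; rewrite table /R3_table; do ?case: ifP => //; lia.
have e1x : R3_br (e 1) (e ix) = e 1.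
  by rewrite table /R3_table; do ?case: ifP => //; lia.
have ex1 : R3_br (e ix) (e 1) = - e 1.
  by rewrite table /R3_table; do ?case: ifP => //; lia.
have eix i : (3 <= i <= n)%N -> R3_br (e i) (e ix) = i.-1%:R *: e i.
  by move=> hi; rewrite table /R3_table; do ?case: ifP => //; lia.
have e2y : R3_br (e 2) (e iy) = e 2.
  by rewrite table /R3_table; do ?case: ifP => //; lia.
have ei0 i j : (0 < i <= n.+2)%N -> (0 < j <= n.+2)%N ->
    [|| (2 <= j <= n)%N, (j == 1%N) && [|| i == 2%N, i == n | i == iy],
        (j == ix) && [|| i == 2%N, i == ix | i == iy] | (j == iy) && (i != 2%N)] ->
    R3_br (e i) (e j) = 0.
  move=> hi hj H; rewrite table // /R3_table.
  by do ?case: ifP => //; lia.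
have e0 i j k : (0 < i <= n.+2)%N -> (2 <= j <= n)%N -> (0 < k <= n.+2)%N ->
    R3_br (e i) (R3_br (e j) (e k)) = 0.
  move=> hi hj hk; rewrite (table j k) //; last by lia.
  rewrite /R3_table; do ?case: ifP => ?;
    rewrite ?Zr ?Or //; first [lia | by rewrite ei0 ?scaler0 //; lia].
have [?|[?|[?|[?|[?|?]]]]] : p = 1%N \/ p = 2%N \/
  (3 <= p <= n.-1)%N \/ p = n \/ p = ix \/ p = iy by lia.
all: have [?|[?|[?|?]]] : q = 1%N \/ (2 <= q <= n)%N \/ q = ix \/ q = iy
  by lia.
all: have [?|[?|[?|?]]] : r = 1%N \/ (2 <= r <= n)%N \/ r = ix \/ r = iy
  by lia.
all: try (rewrite (e0 p q r); [|lia|lia|lia]).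
all: try subst p; try subst q; try subst r.
all: rewrite ?(e11, e1x, ex1, e2y) //.
all: do 4?[
  match goal with
  | |- context [R3_br (e ?i) (e ?j)] =>
    first [ rewrite (ei0 i j); [|lia|lia|lia] | rewrite (eix i); [|lia]
          | rewrite (ei1 i); [|lia] ]
  end; rewrite ?(Zl, Zr, Ol, Or, N1l, N1r, e11, e1x, ex1, e2y)].
all: rewrite ?(Ol, Or, scaler0, oppr0, addr0, add0r, subrr) ?opprK ?addNr //.
all: have nS (a : 'rV[K]_n.+2) i : (0 < i)%N -> a *+ i = a *+ i.-1 + a
  by move=> i_gt0; rewrite -mulrSr prednK.
all: by rewrite !scaler_nat /= ?mulr2n ?addrK // (nS _ p) ?addrK //; lia.
Qed.

End R3.

Definition R3 (K : fieldType) (n : nat) (n_ge3 : (3 <= n)%N) :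
    leibnizAlgebra K :=
  LeibnizAlgebra (@R3_linearl K n) (@R3_linearr K n) (R3_leibniz n_ge3).

(* Main.v *)
(** The vector [q = e_1 + e_2] has trivial stabilizer in the automorphism group:
    since [[q,x] = e_1], [[q,y] = e_2] and [[q,q] = e_3], an automorphism fixing
    [q] is determined by the images of [x] and [y], and the remaining relations
    force these to be [x] and [y].  If [psi] is an automorphism that agrees with
    the 2-local automorphism [phi] at [q], and [psi'] one that agrees with [phi]
    at both [q] and [v], then [psi^-1 psi'] fixes [q], so it is the identity and
    [phi v = psi' v = psi v]; hence [phi = psi]. *)
Require Import Defs.
From mathcomp Require Import all_boot all_order all_algebra.
From mathcomp Require Import zify ring.

Set Implicit Arguments.
Unset Strict Implicit.
Unset Printing Implicit Defensive.

Import GRing.Theory.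
Local Open Scope ring_scope.

(** * Automorphism groups and elements with trivial stabilizer *)

Section Automorphisms.
Variables (K : fieldType) (A : leibnizAlgebra K).
Implicit Types f g : A -> A.

Lemma eq_automorphism f g : f =1 g -> automorphism f -> automorphism g.
Proof.
move=> fg [flin fbij fbr]; split=> [a u v||u v].
- by rewrite -!fg flin.
- exact: eq_bij fg.
- by rewrite -!fg fbr.
Qed.

Lemma comp_automorphism f g :
  automorphism f -> automorphism g -> automorphism (f \o g).
Proof.
move=> [flin fbij fbr] [glin gbij gbr]; split=> [a u v||u v] /=.
- by rewrite glin flin.
- exact: bij_comp.
- by rewrite gbr fbr.
Qed.

Lemma can_automorphism f g :
  automorphism f -> cancel f g -> cancel g f -> automorphism g.
Proof.
move=> [flin fbij fbr] fK gK; split=> [a u v||u v].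
- by apply: (can_inj fK); rewrite flin !gK.
- by exists f.
- by apply: (can_inj fK); rewrite fbr !gK.
Qed.

Lemma two_local_automorphism_trivial_stabilizer (q : A) (phi : A -> A) :
    (forall f, automorphism f -> f q = q -> f =1 id) ->
  two_local_automorphism phi -> automorphism phi.
Proof.
move=> stab1 phi2; have [psi [psiA phiq _]] := phi2 q q.
have [_ [psi' psiK psi'K] _] := psiA.
(* [phi] inherits linearity and bijectivity from [psi] through pointwise equality; [chi] depends on
   [v]. *)
apply: eq_automorphism (psiA) => v; have [chi [chiA chiq ->]] := phi2 q v.
have compA := comp_automorphism (can_automorphism psiA psiK psi'K) chiA.
have chiE : psi' (chi v) = v.
  by apply: (stab1 _ compA); rewrite /= -chiq phiq psiK.
by rewrite -(psi'K (chi v)) chiE.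
Qed.

Lemma lb_brDl (u v w : A) : lb_br (u + v) w = lb_br u w + lb_br v w.
Proof. by have := lb_linearl w 1 u v; rewrite !scale1r. Qed.

Lemma lb_brDr (u v w : A) : lb_br w (u + v) = lb_br w u + lb_br w v.
Proof. by have := lb_linearr w 1 u v; rewrite !scale1r. Qed.

End Automorphisms.

(** * Coordinates of the bracket of [R3] *)

Section R3Coordinates.
Variables (K : fieldType) (n : nat).
Hypothesis n_ge3 : (3 <= n)%N.
Implicit Types u v : 'rV[K]_n.+2.

Local Notation e := (R3_basis K n).
(* Shifted by one from the numbering of the basis: the coordinate of [e k] has
   index [k - 1], those of [x] and [y] have indices [n] and [n + 1]. *)
Definition R3_coord u (k : nat) : K := u 0 (inord k).
Local Notation "u .[# k ]" := (R3_coord u k)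
  (at level 1, left associativity, format "u .[# k ]").

Lemma R3_coordP u v : (forall k, (k <= n.+1)%N -> u.[#k] = v.[#k]) -> u = v.
Proof.
move=> uv; apply/rowP=> i; have := uv i (ltn_ord i).
by rewrite /R3_coord inord_val.
Qed.

Lemma R3_coordD u v k : (u + v).[#k] = u.[#k] + v.[#k].
Proof. by rewrite /R3_coord mxE. Qed.

Lemma R3_coordN u k : (- u).[#k] = - u.[#k].
Proof. by rewrite /R3_coord mxE. Qed.

Lemma R3_coordZ a u k : (a *: u).[#k] = a * u.[#k].
Proof. by rewrite /R3_coord mxE. Qed.

Lemma R3_coord0 k : (0 : 'rV[K]_n.+2).[#k] = 0.
Proof. by rewrite /R3_coord mxE. Qed.

Lemma R3_coord_basis p k : (0 < p <= n.+2)%N -> (k <= n.+1)%N ->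
  (e p).[#k] = (k == p.-1)%:R.
Proof.
move=> hp hk; rewrite /R3_coord /R3_basis mxE eqxx /= -val_eqE /= !inordK //.
  by lia.
Qed.

(** Each coordinate of the bracket is a bilinear form with at most two nonzero coefficients, so two
    slots suffice. A form with fewer terms is padded with coefficient 0 at an arbitrary pair of
    indices. *)
Lemma R3_br_coord u v k (a b : K) (i1 j1 i2 j2 : nat) :
    (i1 <= n.+1)%N -> (j1 <= n.+1)%N -> (i2 <= n.+1)%N -> (j2 <= n.+1)%N ->
    (forall i j, (i <= n.+1)%N -> (j <= n.+1)%N ->
      (R3_table K n i.+1 j.+1).[#k] = a * ((i == i1) && (j == j1))%:R
                                   + b * ((i == i2) && (j == j2))%:R) ->
  (R3_br u v).[#k] = a * (u.[#i1] * v.[#j1]) + b * (u.[#i2] * v.[#j2]).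
Proof.
move=> hi1 hj1 hi2 hj2 tableE.
have pick (c : K) (i0 j0 : nat) : (i0 <= n.+1)%N -> (j0 <= n.+1)%N ->
    \sum_(i < n.+2) \sum_(j < n.+2)
      u 0 i * v 0 j * (c * ((val i == i0) && (val j == j0))%:R)
    = c * (u.[#i0] * v.[#j0]).
  move=> hi0 hj0; rewrite (bigD1 (inord i0)) //= [X in _ + X]big1 => [|i ni].
    rewrite addr0 (bigD1 (inord j0)) //= [X in _ + X]big1 => [|j nj].
      by rewrite addr0 !inordK ?eqxx // mulr1 mulrC.
    by move: nj; rewrite -val_eqE /= inordK // => /negPf->; rewrite andbF !mulr0.
  apply: big1 => j _; move: ni; rewrite -val_eqE /= inordK // => /negPf->.
  by rewrite !mulr0.
rewrite -(pick a) // -(pick b) // -big_split /R3_coord /R3_br summxE /=.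
apply: eq_bigr => i _; rewrite -big_split summxE /=; apply: eq_bigr => j _.
by rewrite mxE -mulrDr -tableE ?(ltn_ord i) ?(ltn_ord j) // -ltnS.
Qed.

(** The case [i = k] is substituted so that the table coefficient [i%:R] becomes [k%:R], which
    [ring] can match; [lia] decides the remaining indicators. *)
Ltac table_cases k :=
  let i := fresh in let j := fresh in
  move=> i j ? ?; case: (eqVneq i k) => [?|?]; try subst i;
  [|case: (eqVneq i.+1 k) => ?]; rewrite /R3_table /=;
  repeat (case: ifP => ?);
  rewrite ?(R3_coordN, R3_coordZ) ?R3_coord0 ?R3_coord_basis; try lia;
  repeat match goal with |- context [nat_of_bool ?b] =>
    first [have -> : b = true by lia | have -> : b = false by lia] end.

Lemma R3_br_coord0 u v : (R3_br u v).[#0] = u.[#0] * v.[#n] - u.[#n] * v.[#0].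
Proof.
rewrite (@R3_br_coord _ _ _ 1 (-1) 0 n n 0) ?mul1r ?mulN1r //; try lia.
by table_cases 0%N; rewrite /=; ring.
Qed.

Lemma R3_br_coord1 u v : (R3_br u v).[#1] = u.[#1] * v.[#n.+1].
Proof.
rewrite (@R3_br_coord _ _ _ 1 0 1 n.+1 0 0); try lia; first by ring.
by table_cases 0%N; rewrite /=; ring.
Qed.

(** Index 2 stands apart because e_3 arises as [e_1, e_1], not as [e_2, e_1]. *)
Lemma R3_br_coord2 u v :
  (R3_br u v).[#2] = u.[#0] * v.[#0] + 2%:R * (u.[#2] * v.[#n]).
Proof.
rewrite (@R3_br_coord _ _ _ 1 2%:R 0 0 2 n); try lia; first by ring.
by table_cases 2%N; rewrite /=; ring.
Qed.

(** The two terms come from [e_k, e_1] = e_{k+1} and [e_{k+1}, x] = k e_{k+1}. *)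
Lemma R3_br_coord_ge3 u v k : (3 <= k < n)%N ->
  (R3_br u v).[#k] = u.[#k.-1] * v.[#0] + k%:R * (u.[#k] * v.[#n]).
Proof.
move=> hk.
rewrite (@R3_br_coord _ _ _ 1 k%:R k.-1 0 k n); try lia; first by ring.
by table_cases k; rewrite /=; ring.
Qed.

Lemma R3_br_coord_ge u v k : (n <= k <= n.+1)%N -> (R3_br u v).[#k] = 0.
Proof.
move=> hk; rewrite (@R3_br_coord _ _ _ 0 0 0 0 0 0); try lia; first by ring.
by table_cases k; rewrite /=; ring.
Qed.

(** The split follows the ranges of the bracket formulas above. *)
Lemma R3_coord_cases u v :
    u.[#0] = v.[#0] -> u.[#1] = v.[#1] -> u.[#2] = v.[#2] ->
    (forall k, (3 <= k < n)%N -> u.[#k] = v.[#k]) ->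
    u.[#n] = v.[#n] -> u.[#n.+1] = v.[#n.+1] ->
  u = v.
Proof.
move=> uv0 uv1 uv2 uvk uvn uvn1; apply: R3_coordP => k hk.
have [->//|[->//|[->//|[/uvk//|[->//|->//]]]]] :
  k = 0%N \/ k = 1%N \/ k = 2%N \/ (3 <= k < n)%N \/ k = n \/ k = n.+1.
  by lia.
Qed.

(** * The stabilizer of e_1 + e_2 *)

Ltac table := by rewrite /R3_table; repeat (case: ifP => ?); try lia.

Lemma R3_automorphism_id (char0 : [pchar K] =i pred0)
    (f : R3 K n_ge3 -> R3 K n_ge3) :
  automorphism f -> f (e 1 + e 2) = e 1 + e 2 -> f =1 id.
Proof.
move=> [flin fbij fbr]; set q := e 1 + e 2 => fq.
have fD u v : f (u + v) = f u + f v by have := flin 1 u v; rewrite !scale1r.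
have f0 : f 0 = 0 by apply: (addIr (f 0)); rewrite -fD !add0r.
have fZ a u : f (a *: u) = a *: f u by have := flin a u 0; rewrite f0 !addr0.
have {}fbr u v : f (R3_br u v) = R3_br (f u) (f v) := fbr u v.
have brDl u v w : R3_br (u + v) w = R3_br u w + R3_br v w :=
  @lb_brDl K (R3 K n_ge3) u v w.
have brDr u v w : R3_br w (u + v) = R3_br w u + R3_br w v :=
  @lb_brDr K (R3 K n_ge3) u v w.
have n_gt0 : (0 < n)%N by lia.
have natr0 k : (0 < k)%N -> k%:R != 0 :> K.
  (* Characteristic zero allows cancelling the factors k in [e_{k+1}, x] = k e_{k+1}. *)
  by move/GRing.pcharf0P: char0 => ->; rewrite lt0n.
have natr_inj k a : (0 < k)%N -> k%:R * a = 0 -> a = 0 :> K.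
  by move=> /natr0/negPf kn0 /eqP; rewrite mulf_eq0 kn0 => /eqP.
have br p r c : (0 < p <= n.+2)%N -> (0 < r <= n.+2)%N ->
    R3_table K n p r = c -> R3_br (e p) (e r) = c.
  by move=> hp hr <-; apply: R3_br_basis.
pose x := e n.+1; pose y := e n.+2.
have brqq : R3_br q q = e 3.
  rewrite brDl !brDr !(br 1%N 1%N (e 3), br 1%N 2%N 0, br 2%N 1%N 0, br 2%N 2%N 0) ?addr0 //;
    try lia; table.
have brqx : R3_br q x = e 1.
  by rewrite brDl (br 1%N _ (e 1)) ?(br 2%N _ 0) ?addr0 //; try lia; table.
have brqy : R3_br q y = e 2.
  by rewrite brDl (br 1%N _ 0) ?(br 2%N _ (e 2)) ?add0r //; try lia; table.
have br3x : R3_br (e 3) x = 2%:R *: e 3 by apply: br; try lia; table.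
have br3y : R3_br (e 3) y = 0 by apply: br; try lia; table.
have br2x : R3_br (e 2) x = 0 by apply: br; try lia; table.
have brxx : R3_br x x = 0 by apply: br; try lia; table.
have brxy : R3_br x y = 0 by apply: br; try lia; table.
have bryx : R3_br y x = 0 by apply: br; try lia; table.
have bryy : R3_br y y = 0 by apply: br; try lia; table.
have fe3 : f (e 3) = e 3 by rewrite -brqq fbr fq.
pose X := f x; pose Y := f y.
have fe1 : f (e 1) = R3_br q X by rewrite -brqx fbr fq.
have fe2 : f (e 2) = R3_br q Y by rewrite -brqy fbr fq.
have qk k : (k <= n.+1)%N -> q.[#k] = (k == 0)%:R + (k == 1)%:R.
  by move=> hk; rewrite R3_coordD !R3_coord_basis //; lia.
have q0 : q.[#0] = 1 by rewrite qk // addr0.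
have q1 : q.[#1] = 1 by rewrite qk // add0r.
have qk0 k : (2 <= k <= n.+1)%N -> q.[#k] = 0.
  by move=> hk; rewrite qk; last lia; case: k hk => [|[|k]] // _; rewrite addr0.
have ek0 p k : (0 < p <= n.+2)%N -> (k <= n.+1)%N -> k != p.-1 ->
    (e p).[#k] = 0.
  by move=> hp hk kp; rewrite R3_coord_basis // (negPf kp).
have ek1 p : (0 < p <= n.+2)%N -> (e p).[#p.-1] = 1.
  by move=> hp; rewrite R3_coord_basis ?eqxx //; lia.
(* As e_3 is fixed, [e_3, x] = 2 e_3 and [e_3, y] = 0 determine the x-coordinates of [X] and [Y]. *)
have Xn : X.[#n] = 1.
  have := congr1 (R3_coord^~ 2%N) (congr1 f br3x).
  rewrite /= fbr fZ fe3 R3_br_coord2 R3_coordZ (ek1 3%N) // ek0 //.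
  by rewrite mul0r add0r mul1r => /(mulfI (natr0 2%N isT)).
have Yn : Y.[#n] = 0.
  have := congr1 (R3_coord^~ 2%N) (congr1 f br3y).
  rewrite /= fbr f0 fe3 R3_br_coord2 R3_coord0 (ek1 3%N) // ek0 //.
  by rewrite mul0r add0r mul1r => /natr_inj->.
have fe12 k : (f (e 1)).[#k] + (f (e 2)).[#k] = q.[#k].
  by rewrite -R3_coordD -fD fq.
have qn : q.[#n] = 0 by rewrite qk0 //; lia.
have fe20 : (f (e 2)).[#0] = 0.
  by rewrite fe2 R3_br_coord0 Yn qn mulr0 mul0r subr0.
have fe22 : (f (e 2)).[#2] = Y.[#0].
  by rewrite fe2 R3_br_coord2 q0 Yn mul1r !mulr0 addr0.
have fe21 : (f (e 2)).[#1] = Y.[#n.+1] by rewrite fe2 R3_br_coord1 q1 mul1r.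
have fe11 : (f (e 1)).[#1] = X.[#n.+1] by rewrite fe1 R3_br_coord1 q1 mul1r.
(* The e_3-coordinate of [f e_2, X] = 0 is 2 [Y.[#0]]. *)
have Y0 : Y.[#0] = 0.
  have := congr1 (R3_coord^~ 2%N) (congr1 f br2x).
  rewrite /= fbr f0 R3_br_coord2 R3_coord0 fe20 fe22 Xn mul0r add0r mulr1.
  exact: natr_inj.
(* The e_3-coordinates of f e_1 and f e_2 are [X.[#0]] and [Y.[#0]]; they sum to that of [q], which
   is 0. *)
have X0 : X.[#0] = 0.
  have := fe12 2%N; rewrite fe22 Y0 addr0 fe1 R3_br_coord2 q0 !qk0 //.
  by rewrite mul1r mul0r mulr0 addr0.
have fe2E : f (e 2) = Y.[#n.+1] *: e 2.
  apply: R3_coord_cases => [|||k hk||]; rewrite R3_coordZ.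
  - by rewrite fe20 ek0 ?mulr0.
  - by rewrite fe21 (ek1 2%N) ?mulr1.
  - by rewrite fe22 Y0 ek0 ?mulr0.
  - by rewrite fe2 R3_br_coord_ge3 // Y0 Yn ek0 ?mulr0 ?addr0 //; lia.
  - by rewrite fe2 R3_br_coord_ge ?ek0 ?mulr0 //; lia.
  - by rewrite fe2 R3_br_coord_ge ?ek0 ?mulr0 //; lia.
(* Otherwise f e_2 = 0, against injectivity. The e_2-coordinate of [f e_2, X] = 0 then kills
   [X.[#n.+1]], and f e_1 + f e_2 = q gives [Y.[#n.+1] = 1]. *)
have Yy_neq0 : Y.[#n.+1] != 0.
  apply/eqP => Yy0; have : e 2 = 0.
    by apply: (bij_inj fbij); rewrite fe2E Yy0 scale0r f0.
  move/(congr1 (R3_coord^~ 1%N)); rewrite /= (ek1 2%N) // R3_coord0.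
  exact/eqP/oner_neq0.
have Xy : X.[#n.+1] = 0.
  have := congr1 (R3_coord^~ 1%N) (congr1 f br2x).
  rewrite /= fbr f0 R3_br_coord1 R3_coord0 fe21 => /eqP.
  by rewrite mulf_eq0 (negPf Yy_neq0) => /eqP.
have Yy : Y.[#n.+1] = 1 by have := fe12 1%N; rewrite fe11 fe21 Xy q1 add0r.
have {}fe2 : f (e 2) = e 2 by rewrite fe2E Yy scale1r.
have {}fe1 : f (e 1) = e 1 by apply: (addIr (e 2)); rewrite -{1}fe2 -fD.
(* With [X.[#0] = 0] and [X.[#n] = 1], [X, X] = 0 reads k [X.[#k]] = 0 for 2 <= k < n; the
   e_2-coordinate vanishes by [X, Y] = 0. *)
have fX : X = x.
  have brXX : R3_br X X = 0 by rewrite -fbr brxx f0.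
  apply: R3_coord_cases => [|||k hk||].
  - by rewrite X0 ek0 //; lia.
  - have := congr1 (R3_coord^~ 1%N) (congr1 f brxy).
    by rewrite /= fbr f0 R3_br_coord1 R3_coord0 Yy mulr1 ek0 //; lia.
  - have := congr1 (R3_coord^~ 2%N) brXX.
    rewrite /= R3_br_coord2 R3_coord0 X0 mul0r add0r Xn mulr1 => /natr_inj-> //.
    by rewrite ek0 //; lia.
  - have := congr1 (R3_coord^~ k) brXX.
    rewrite /= R3_br_coord_ge3 // R3_coord0 X0 mulr0 add0r Xn mulr1.
    by move=> /natr_inj->; rewrite ?ek0 //; lia.
  - by rewrite Xn (ek1 n.+1) //; lia.
  - by rewrite Xy ek0 //; lia.
(* Same argument, with [Y, X] = 0 and, for the e_2-coordinate, [Y, Y] = 0. *)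
have fY : Y = y.
  have brYX : R3_br Y X = 0 by rewrite -fbr bryx f0.
  apply: R3_coord_cases => [|||k hk||].
  - by rewrite Y0 ek0 //; lia.
  - have := congr1 (R3_coord^~ 1%N) (congr1 f bryy).
    by rewrite /= fbr f0 R3_br_coord1 R3_coord0 Yy mulr1 ek0 //; lia.
  - have := congr1 (R3_coord^~ 2%N) brYX.
    rewrite /= R3_br_coord2 R3_coord0 Y0 mul0r add0r Xn mulr1 => /natr_inj-> //.
    by rewrite ek0 //; lia.
  - have := congr1 (R3_coord^~ k) brYX.
    rewrite /= R3_br_coord_ge3 // R3_coord0 X0 mulr0 add0r Xn mulr1.
    by move=> /natr_inj->; rewrite ?ek0 //; lia.
  - by rewrite Yn ek0 //; lia.
  - by rewrite Yy (ek1 n.+2) //; lia.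
(* Induction along e_{k+1} = [e_k, e_1], starting from e_3. *)
have fe k : (3 <= k <= n)%N -> f (e k) = e k.
  elim: k => // k IHk hk; have [->//|k3] := eqVneq k 2.
  have brk1 : R3_br (e k) (e 1) = e k.+1 by apply: br; try lia; table.
  by rewrite -brk1 fbr fe1 IHk //; lia.
have fek p : (0 < p <= n.+2)%N -> f (e p) = e p.
  move=> hp.
  have [->//|[->//|[/fe//|[->//|->//]]]] :
    p = 1%N \/ p = 2%N \/ (3 <= p <= n)%N \/ p = n.+1 \/ p = n.+2 by lia.
move=> u; rewrite /= [u]row_sum_delta (big_morph f fD f0).
apply: eq_bigr => i _; rewrite fZ; congr (_ *: _).
by have := fek i.+1; rewrite /R3_basis /= inord_val => ->.
Qed.

End R3Coordinates.

Theorem theorem4p4 (K : fieldType) (n : nat)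
    (char0 : [pchar K]%R =i pred0) (n_ge3 : (3 <= n)%N)
    (phi : R3 K n_ge3 -> R3 K n_ge3) :
  two_local_automorphism phi -> automorphism phi.
Proof.
apply: (@two_local_automorphism_trivial_stabilizer K (R3 K n_ge3)
          (R3_basis K n 1 + R3_basis K n 2)).
by move=> f; apply: R3_automorphism_id.
Qed.
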